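(* For every $\Gamma\cup\{\varphi\}\subseteq\mathcal{L}$, $\Gamma\vdash\varphi$ (in $\mathbf{mb}^\bigstar$) if and only if $\Gamma\Vdash_{\mathbb{P}}\varphi$, where $\Vdash_{\mathbb{P}}$ is the probabilistic semantic relation for $\mathbf{mb}^\bigstar$.
   Context: Let $V$ be a denumerable set of propositional variables and let $\mathcal{L}$ be the set of formulas generated freely from $V$ by the binary connectives $\land,\lor,\longrightarrow$ and the unary connectives $\neg,\bigstar$. The logic $\mathbf{mb}^\bigstar=\langle\mathcal{L},\vdash\rangle$ is given by the Hilbert-style system with the following axiom schemas (for all $\alpha,\beta,\gamma\in\mathcal{L}$): (1) $\alpha\longrightarrow(\beta\longrightarrow\alpha)$; (2) $(\alpha\longrightarrow\beta)\longrightarrow((\alpha\longrightarrow(\beta\longrightarrow\gamma))\longrightarrow(\alpha\longrightarrow\gamma))$; (3) $\alpha\longrightarrow(\beta\longrightarrow(\alpha\land\beta))$; (4) $(\alpha\land\beta)\longrightarrow\alpha$; (5) $(\alpha\land\beta)\longrightarrow\beta$; (6) $\alpha\longrightarrow(\alpha\lor\beta)$; (7) $\beta\longrightarrow(\alpha\lor\beta)$; (8) $(\alpha\longrightarrow\gamma)\longrightarrow((\beta\longrightarrow\gamma)\longrightarrow((\alpha\lor\beta)\longrightarrow\gamma))$; (9) $\alpha\lor(\alpha\longrightarrow\beta)$; (10) $\alpha\longrightarrow(\neg\alpha\longrightarrow\beta)$; (11) $(\alpha\lor\neg\alpha)\lor\bigstar\alpha$; and the single inference rule modus ponens (from $\alpha$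 and $\alpha\longrightarrow\beta$ infer $\beta$). For $\Gamma\cup\{\varphi\}\subseteq\mathcal{L}$, $\Gamma\vdash\varphi$ means there is a finite sequence of formulas ending in $\varphi$, each of which is an axiom instance, an element of $\Gamma$, or obtained from two earlier members by modus ponens. We write $\vdash\varphi$ for $\emptyset\vdash\varphi$ and $\psi\vdash\varphi$ for $\{\psi\}\vdash\varphi$. An $\mathbf{mb}^\bigstar$-probability function is a function $P:\mathcal{L}\to[0,1]$ such that for all $\varphi,\psi\in\mathcal{L}$: (i) if $\vdash\varphi$ then $P(\varphi)=1$; (ii) if $\varphi\vdash\chi$ for all $\chi\in\mathcal{L}$, then $P(\varphi)=0$; (iii) if $\psi\vdash\varphi$ then $P(\psi)\le P(\varphi)$; (iv) $P(\varphi\lor\psi)=P(\varphi)+P(\psi)-P(\varphi\land\psi)$. The probabilistic semantic relation $\Vdash_{\mathbb{P}}$ for $\mathbf{mb}^\bigstar$ is defined by: $\Gamma\Vdash_{\mathbb{P}}\varphi$ iff for every $\mathbf{mb}^\bigstar$-probability function $P$, $P(\varphi)=1$ whenever $P(\psi)=1$ for every $\psi\in\Gamma$. *)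

(* Defs.v *)
From Stdlib Require Import Reals List FinFun Ensembles.
Import ListNotations.

Set Implicit Arguments.
Unset Strict Implicit.

Definition denumerable (V : Type) : Prop := exists f : V -> nat, Bijective f.

Inductive formula (V : Type) : Type :=
| Var (p : V)
| And (a b : formula V)
| Or (a b : formula V)
| Imp (a b : formula V)
| Neg (a : formula V)
| Star (a : formula V).

Declare Scope mb_scope.
Delimit Scope mb_scope with mb.
Bind Scope mb_scope with formula.

Infix "&&&" := And (at level 40, left associativity) : mb_scope.
Infix "|||" := Or (at level 50, left associativity) : mb_scope.
Infix "-->" := Imp (at level 55, right associativity) : mb_scope.
Notation "~~ a" := (Neg a) (at level 35, right associativity) : mb_scope.
Notation "'[*]' a" := (Star a) (at level 35, right associativity) : mb_scope.

Section Logic.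

Variable V : Type.
Local Open Scope mb_scope.

Inductive mb_axiom : formula V -> Prop :=
| mb_ax1 a b : mb_axiom (a --> (b --> a))
| mb_ax2 a b c : mb_axiom ((a --> b) --> ((a --> (b --> c)) --> (a --> c)))
| mb_ax3 a b : mb_axiom (a --> (b --> (a &&& b)))
| mb_ax4 a b : mb_axiom ((a &&& b) --> a)
| mb_ax5 a b : mb_axiom ((a &&& b) --> b)
| mb_ax6 a b : mb_axiom (a --> (a ||| b))
| mb_ax7 a b : mb_axiom (b --> (a ||| b))
| mb_ax8 a b c : mb_axiom ((a --> c) --> ((b --> c) --> ((a ||| b) --> c)))
| mb_ax9 a b : mb_axiom (a ||| (a --> b))
| mb_ax10 a b : mb_axiom (a --> (~~ a --> b))
| mb_ax11 a : mb_axiom ((a ||| ~~ a) ||| [*] a).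

Definition derivation (Gamma : Ensemble (formula V)) (s : list (formula V))
    : Prop :=
  forall i b, nth_error s i = Some b ->
    mb_axiom b \/ In _ Gamma b \/
    exists j k a, j < i /\ k < i /\
      nth_error s j = Some a /\ nth_error s k = Some (a --> b).

Definition derives (Gamma : Ensemble (formula V)) (phi : formula V) : Prop :=
  exists s, derivation Gamma (s ++ [phi]).

Local Open Scope R_scope.

Record probability_function (P : formula V -> R) : Prop := {
  prob_range : forall phi, 0 <= P phi <= 1;
  prob_theorem : forall phi, derives (Empty_set _) phi -> P phi = 1;
  prob_trivializing : forall phi,
    (forall chi, derives (Singleton _ phi) chi) -> P phi = 0;
  prob_mono : forall phi psi, derives (Singleton _ psi) phi -> P psi <= P phi;
  prob_or : forall phi psi, P (phi ||| psi) = P phi + P psi - P (phi &&& psi)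
}.

Definition prob_entails (Gamma : Ensemble (formula V)) (phi : formula V)
    : Prop :=
  forall P, probability_function P ->
    (forall psi, In _ Gamma psi -> P psi = 1) -> P phi = 1.

End Logic.

(* Main.v *)
(** Soundness: if P a = P (a --> b) = 1, then inclusion-exclusion forces
    P (a &&& (a --> b)) = 1, and this conjunction entails b; so the formulas of
    probability 1 are closed under modus ponens.
    Completeness: if Gamma does not derive phi, extend Gamma to a theory maximal
    among those not deriving phi.  Such a theory is prime, so its 0/1-valued
    characteristic function is a probability function; it is 1 on Gamma and 0
    at phi. *)

From Stdlib Require Import Reals Lra Lia List Cantor ClassicalEpsilon.
Require Import Defs.
From Stdlib Require Import Ensembles.
Import ListNotations.

Set Implicit Arguments.
Unset Strict Implicit.

(** * Hilbert derivability and its derived rules *)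

Section Provability.

Variable V : Type.
Implicit Types (G D : Ensemble (formula V)) (a b c phi : formula V).
Local Open Scope mb_scope.

(** Tree-shaped form of [derives], so that later proofs can use rule induction instead of positions
    in a list. *)
Inductive prov G : formula V -> Prop :=
| prov_ax a : mb_axiom a -> prov G a
| prov_hyp a : In _ G a -> prov G a
| prov_mp a b : prov G a -> prov G (a --> b) -> prov G b.

Lemma derivation_cat G s t :
  derivation G s -> derivation G t -> derivation G (s ++ t).
Proof.
  intros Hs Ht i b Hi.
  destruct (Nat.lt_ge_cases i (length s)) as [Hlt | Hge].
  - rewrite nth_error_app1 in Hi by exact Hlt.
    destruct (Hs _ _ Hi) as [H | [H | (j & k & a & Hj & Hk & Ha & Hab)]]; auto.
    right; right; exists j, k, a.
    rewrite !nth_error_app1 by lia; auto.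
  - rewrite nth_error_app2 in Hi by exact Hge.
    destruct (Ht _ _ Hi) as [H | [H | (j & k & a & Hj & Hk & Ha & Hab)]]; auto.
    right; right; exists (length s + j), (length s + k), a.
    rewrite !nth_error_app2 by lia.
    replace (length s + j - length s) with j by lia.
    replace (length s + k - length s) with k by lia.
    repeat split; auto; lia.
Qed.

Lemma derivation_rcons G s b :
  derivation G s ->
  mb_axiom b \/ In _ G b \/ (exists a, List.In a s /\ List.In (a --> b) s) ->
  derivation G (s ++ [b]).
Proof.
  intros Hs Hb i c Hi.
  destruct (Nat.lt_ge_cases i (length s)) as [Hlt | Hge].
  - rewrite nth_error_app1 in Hi by exact Hlt.
    destruct (Hs _ _ Hi) as [H | [H | (j & k & a & Hj & Hk & Ha & Hab)]]; auto.
    right; right; exists j, k, a.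
    rewrite !nth_error_app1 by lia; auto.
  - rewrite nth_error_app2 in Hi by exact Hge.
    destruct (i - length s) as [| m]; simpl in Hi;
      [injection Hi as <- | destruct m; discriminate Hi].
    destruct Hb as [H | [H | (a & Ha & Hab)]]; auto.
    apply In_nth_error in Ha as [j Ha].
    apply In_nth_error in Hab as [k Hab].
    assert (Hj : j < length s) by (apply nth_error_Some; congruence).
    assert (Hk : k < length s) by (apply nth_error_Some; congruence).
    right; right; exists j, k, a.
    rewrite !nth_error_app1 by assumption.
    repeat split; auto; lia.
Qed.

Lemma derives_prov G a : derives G a <-> prov G a.
Proof.
  split.
  - intros [s Hs].
    assert (H : forall i b, nth_error (s ++ [a]) i = Some b -> prov G b).
    { induction i as [i IH] using (well_founded_induction Wf_nat.lt_wf).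
      intros b Hi.
      destruct (Hs _ _ Hi) as [H | [H | (j & k & c & Hj & Hk & Hc & Hcb)]].
      - now apply prov_ax.
      - now apply prov_hyp.
      - apply prov_mp with c; eauto. }
    apply (H (length s)).
    now rewrite nth_error_app2, Nat.sub_diag.
  - assert (nilD : derivation G []) by (intros [|] ? [=]).
    induction 1 as [a Ha | a Ha | a b _ [s Hs] _ [t Ht]].
    + exists []; apply derivation_rcons; auto.
    + exists []; apply derivation_rcons; auto.
    (* Concatenating the two derivations places both premises before the final [b]. *)
    + exists ((s ++ [a]) ++ (t ++ [a --> b])).
      apply derivation_rcons; [now apply derivation_cat |].
      right; right; exists a; rewrite !in_app_iff; simpl; auto.
Qed.

Lemma prov_mono G D a : Included _ G D -> prov G a -> prov D a.
Proof.
  intros HGD; induction 1 as [a Ha | a Ha | a b _ IHa _ IHab].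
  - now apply prov_ax.
  - now apply prov_hyp, HGD.
  - exact (prov_mp IHa IHab).
Qed.

Lemma prov_weaken G a b : prov G b -> prov G (a --> b).
Proof.
  intros Hb; apply prov_mp with b; [exact Hb | apply prov_ax, mb_ax1].
Qed.

Lemma prov_imp_refl G a : prov G (a --> a).
Proof.
  apply prov_mp with (a --> ((a --> a) --> a)); [apply prov_ax, mb_ax1 |].
  apply prov_mp with (a --> (a --> a)); apply prov_ax; constructor.
Qed.

(** Modus ponens is the only rule, so axioms 1 and 2 suffice: axiom 2 carries it under the
    antecedent [a]. *)
Lemma deduction G a b : prov (Add _ G a) b -> prov G (a --> b).
Proof.
  induction 1 as [b Hb | b Hb | b c _ IHb _ IHbc].
  - now apply prov_weaken, prov_ax.
  - destruct Hb as [b Hb | b []].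
    + now apply prov_weaken, prov_hyp.
    + apply prov_imp_refl.
  - apply (prov_mp IHbc), (prov_mp IHb), prov_ax, mb_ax2.
Qed.

Lemma prov_cut G a b : prov G a -> prov (Add _ G a) b -> prov G b.
Proof. intros Ha Hb; exact (prov_mp Ha (deduction Hb)). Qed.

Lemma prov_and G a b : prov G (a &&& b) <-> prov G a /\ prov G b.
Proof.
  split.
  - intros H; split; apply (prov_mp H), prov_ax; constructor.
  - intros [Ha Hb]; apply (prov_mp Hb), (prov_mp Ha), prov_ax, mb_ax3.
Qed.

Lemma prov_or_elim G a b c :
  prov G (a ||| b) -> prov (Add _ G a) c -> prov (Add _ G b) c -> prov G c.
Proof.
  intros H Ha Hb.
  apply (prov_mp H), (prov_mp (deduction Hb)), (prov_mp (deduction Ha)).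
  apply prov_ax, mb_ax8.
Qed.

(** * Formulas of probability 1 are closed under derivation *)

Section Soundness.

Local Open Scope R_scope.

Variable P : formula V -> R.
Hypothesis HP : probability_function P.

Lemma prob_certain_mp a b : P a = 1 -> P (a --> b) = 1 -> P b = 1.
Proof.
  intros Ha Hab.
  assert (Hle : P (a &&& (a --> b)) <= P b).
  { apply (prob_mono HP), derives_prov.
    assert (H : prov (Singleton _ (a &&& (a --> b))) (a &&& (a --> b)))
      by (apply prov_hyp; constructor).
    apply prov_and in H as [H1 H2]; exact (prov_mp H1 H2). }
  (* The disjunction has probability at most 1, so the conjunction has at least 1 + 1 - 1. *)
  pose proof (prob_or HP a (a --> b)).
  pose proof (prob_range HP (a ||| (a --> b))).
  pose proof (prob_range HP b).
  lra.
Qed.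

Lemma prob_certain_prov G a :
  (forall b, In _ G b -> P b = 1) -> prov G a -> P a = 1.
Proof.
  intros HG; induction 1 as [a Ha | a Ha | a b _ IHa _ IHab].
  - now apply (prob_theorem HP), derives_prov, prov_ax.
  - now apply HG.
  - exact (prob_certain_mp IHa IHab).
Qed.

End Soundness.

(** * Maximal extension of [G] not deriving [phi] *)

Section Lindenbaum.

Variable code : formula V -> nat.
Hypothesis code_inj : forall a b, code a = code b -> a = b.
Variables (G : Ensemble (formula V)) (phi : formula V).
Hypothesis HG : ~ prov G phi.

(** Step [n] examines the formula with code [n]. When [n] codes no formula, nothing is added, so an
    injective coding serves as an enumeration. *)
Fixpoint stage (n : nat) : Ensemble (formula V) :=
  match n with
  | 0 => G
  | S n => fun a =>
      stage n a \/ (code a = n /\ ~ prov (Add _ (stage n) a) phi)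
  end.

Definition saturation : Ensemble (formula V) := fun a => exists n, stage n a.

Lemma stage_le m n : m <= n -> Included _ (stage m) (stage n).
Proof.
  induction 1 as [| n _ IH]; intros a Ha; [exact Ha | left; now apply IH].
Qed.

(** By injectivity of [code], each step adds at most one formula, and that formula has passed the
    test of not yielding [phi]. *)
Lemma stage_consistent n : ~ prov (stage n) phi.
Proof.
  induction n as [| n IH]; [exact HG |].
  intros Hphi.
  destruct (classic (exists a, code a = n /\ ~ prov (Add _ (stage n) a) phi))
    as [(a & Ha & Hna) | Hnone].
  - apply Hna; revert Hphi; apply prov_mono.
    intros b [Hb | [Hb _]]; [now left | right].
    rewrite (code_inj (eq_trans Hb (eq_sym Ha))); constructor.
  - apply IH; revert Hphi; apply prov_mono.
    intros b [Hb | Hb]; [exact Hb | destruct Hnone; now exists b].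
Qed.

(** Compactness: the stages increase, so the two premises of a modus ponens are both available at
    the later of their stages. *)
Lemma prov_saturation_stage a : prov saturation a -> exists n, prov (stage n) a.
Proof.
  induction 1 as [a Ha | a [n Ha] | a b _ [m Hm] _ [n Hn]].
  - exists 0; now apply prov_ax.
  - exists n; now apply prov_hyp.
  - exists (Nat.max m n); apply prov_mp with a.
    + revert Hm; apply prov_mono, stage_le; lia.
    + revert Hn; apply prov_mono, stage_le; lia.
Qed.

Lemma saturation_consistent : ~ prov saturation phi.
Proof.
  intros [n Hn]%prov_saturation_stage; exact (stage_consistent Hn).
Qed.

Lemma saturation_maximal a :
  ~ In _ saturation a -> prov (Add _ saturation a) phi.
Proof.
  intros Ha; apply NNPP; intros Hphi; apply Ha.
  (* [a] is examined at stage [code a]; passing the test there would put it into the next stage. *)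
  exists (S (code a)); right; split; [reflexivity |].
  intros H; apply Hphi; revert H; apply prov_mono.
  intros b [b' Hb | b' Hb]; [left; now exists (code a) | now right].
Qed.

Lemma saturation_closed a : prov saturation a -> In _ saturation a.
Proof.
  intros Ha; apply NNPP; intros Hn.
  exact (saturation_consistent (prov_cut Ha (saturation_maximal Hn))).
Qed.

Lemma saturation_and a b :
  In _ saturation (a &&& b) <-> In _ saturation a /\ In _ saturation b.
Proof.
  split.
  - intros [Ha Hb]%prov_hyp%prov_and; split; now apply saturation_closed.
  - intros [Ha Hb]; apply saturation_closed, prov_and.
    split; now apply prov_hyp.
Qed.

(** Primeness: if neither disjunct belonged, maximality would derive [phi] from each, and case
    analysis would derive [phi] outright. *)
Lemma saturation_or a b :
  In _ saturation (a ||| b) <-> In _ saturation a \/ In _ saturation b.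
Proof.
  split.
  - intros H; apply NNPP; intros Hn; apply saturation_consistent.
    apply (prov_or_elim (prov_hyp H)); apply saturation_maximal; tauto.
  - intros [H | H]; apply saturation_closed, (prov_mp (prov_hyp H)), prov_ax;
      constructor.
Qed.

Local Open Scope R_scope.

(** Membership need not be decidable, hence the informative excluded middle to define a real value
    from it. *)
Definition saturation_prob a : R :=
  if excluded_middle_informative (In _ saturation a) then 1 else 0.

Lemma saturation_prob_in a : In _ saturation a -> saturation_prob a = 1.
Proof.
  unfold saturation_prob; now destruct (excluded_middle_informative _).
Qed.

Lemma saturation_prob_notin a : ~ In _ saturation a -> saturation_prob a = 0.
Proof.
  unfold saturation_prob; now destruct (excluded_middle_informative _).
Qed.

Lemma prov_singleton_saturation a b :
  In _ saturation a -> prov (Singleton _ a) b -> In _ saturation b.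
Proof.
  intros Ha Hb; apply saturation_closed; revert Hb; apply prov_mono.
  now intros c [].
Qed.

Lemma saturation_probability_function : probability_function saturation_prob.
Proof.
  assert (range : forall a, 0 <= saturation_prob a <= 1).
  { intros a; unfold saturation_prob.
    destruct (excluded_middle_informative _); lra. }
  constructor.
  - exact range.
  - intros a Ha%derives_prov; apply saturation_prob_in, saturation_closed.
    revert Ha; apply prov_mono; intros b [].
  - intros a Ha; apply saturation_prob_notin; intros Hin.
    apply saturation_consistent, prov_hyp.
    now apply (prov_singleton_saturation Hin), derives_prov.
  - intros a b Hba%derives_prov.
    destruct (classic (In _ saturation b)) as [Hb | Hb].
    + rewrite (saturation_prob_in (prov_singleton_saturation Hb Hba)).
      apply range.
    + rewrite (saturation_prob_notin Hb); apply range.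
  (* Since membership commutes with [And] and [Or], inclusion-exclusion reduces to a check of 0/1
     values. *)
  - intros a b; unfold saturation_prob.
    pose proof (saturation_and a b); pose proof (saturation_or a b).
    repeat destruct (excluded_middle_informative _); tauto || lra.
Qed.

End Lindenbaum.

(** * Coding of formulas by Cantor pairing, and the final equivalence *)

Fixpoint formula_code (f : V -> nat) a : nat :=
  match a with
  | Var p => to_nat (0, f p)
  | And a b => to_nat (1, to_nat (formula_code f a, formula_code f b))
  | Or a b => to_nat (2, to_nat (formula_code f a, formula_code f b))
  | Imp a b => to_nat (3, to_nat (formula_code f a, formula_code f b))
  | Neg a => to_nat (4, formula_code f a)
  | Star a => to_nat (5, formula_code f a)
  end.

Lemma formula_code_inj (f : V -> nat) :
  (forall p q, f p = f q -> p = q) ->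
  forall a b, formula_code f a = formula_code f b -> a = b.
Proof.
  (* Distinct constructor tags refute the mixed cases; binary connectives need a second
     unpairing. *)
  intros Hf; induction a; destruct b; cbn [formula_code];
    intros [Hc H]%to_nat_inj%pair_equal_spec; try discriminate Hc;
    try apply to_nat_inj, pair_equal_spec in H as [H1 H2]; f_equal; auto.
Qed.

End Provability.

Theorem theorem3p6 (V : Type) (HV : denumerable V)
    (Gamma : Ensemble (formula V)) (phi : formula V) :
  derives Gamma phi <-> prob_entails Gamma phi.
Proof.
  split.
  - intros H%derives_prov P HP HG; exact (prob_certain_prov HP HG H).
  - intros H; apply derives_prov, NNPP; intros Hphi.
    destruct HV as (f & g & gf & _).
    assert (f_inj : forall p q, f p = f q -> p = q) by congruence.
    pose proof (formula_code_inj f_inj) as code_inj.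
    specialize (H _ (saturation_probability_function code_inj Hphi)).
    rewrite saturation_prob_notin in H.
    + apply R1_neq_R0; symmetry; apply H.
      (* [Gamma] is stage 0 of the saturation, so its members have probability 1 and [H] yields
         [0 = 1]. *)
      intros a Ha; apply saturation_prob_in; now exists 0.
    + intros Hin.
      exact (saturation_consistent code_inj Hphi (prov_hyp Hin)).
Qed.
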